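(* Let $\zeta$ be a real random variable with finite mathematical expectation, with $P\{\zeta>0\}>0$ and $P\{\zeta\le 0\}>0$, and put $E^- = \big|\mathrm{E}(\zeta \mid \zeta \le 0)\big|$ and $E^+ = \mathrm{E}(\zeta \mid \zeta > 0)$, with $E^->0$. Let $n\ge 1$ be an integer, and let a society consist of $n$ egoists, the utility increments in a random proposal being independent copies of $\zeta$. Then $$\alpha_0 = \left(1+\frac{E^+}{E^-}\right)^{-1}$$ is an optimal voting threshold, i.e. $\mathrm{E}(\eta_i(\alpha_0)) \ge \mathrm{E}(\eta_i(\alpha))$ for every $\alpha\in[-\tfrac1n,1]$ and every $i\in\{1,\dots,n\}$.
   Context: Setting (ViSE model, society of $n$ egoists): a random proposal is a vector $\boldsymbol\zeta=(\zeta_1,\ldots,\zeta_n)$ of independent identically distributed real random variables, each distributed as $\zeta$; $\zeta_i$ is the proposed utility increment of agent $i$. Each agent (egoist) votes for the proposal if and only if his/her own proposed increment is positive. For a relative voting threshold $\alpha\in[-\frac1n,1]$, the proposal is accepted if and only if $\#\{k:\zeta_k>0,\ k=1,\ldots,n\}>\alpha n$. The actual utility increments are $\eta_i(\alpha)=\zeta_i\, I(\boldsymbol\zeta,\alpha n)$, where $I(\boldsymbol\zeta,\alpha n)=1$ if $\#\{k:\zeta_k>0\}>\alpha n$ and $I(\boldsymbol\zeta,\alpha n)=0$ otherwise. A threshold in $[-\frac1n,1]$ is called optimal if it provides the highest possible expected utility increment $\mathrm{E}(\eta_i(\alpha))$ of an agent (this expectation does not depend on $i$). Optimal thresholds are not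 unique: if $\alpha$ is optimal and $\alpha_1$ satisfies $\lfloor\alpha_1 n\rfloor=\lfloor\alpha n\rfloor$, then $\alpha_1$ is also optimal. *)

(* Defs.v *)
From mathcomp Require Import all_boot all_order all_algebra.
From mathcomp Require Import all_classical all_reals all_analysis.

Set Implicit Arguments.
Unset Strict Implicit.
Unset Printing Implicit Defensive.

Import Order.TTheory GRing.Theory Num.Theory.

Local Open Scope classical_set_scope.
Local Open Scope ring_scope.

(* E(X | A) for an event A of positive probability; the value is 0 when
   P A = 0 and is meaningful only for integrable X. *)
Definition cond_expectation (R : realType) (d : measure_display)
    (T : measurableType d) (P : probability T R) (X : T -> R) (A : set T) : R :=
  fine 'E_P[fun w => X w * \1_A w] / fine (P A).

Definition E_plus (R : realType) (d : measure_display) (T : measurableType d)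
    (P : probability T R) (X : T -> R) : R :=
  cond_expectation P X [set w | 0 < X w].

Definition E_minus (R : realType) (d : measure_display) (T : measurableType d)
    (P : probability T R) (X : T -> R) : R :=
  `|cond_expectation P X [set w | X w <= 0]|.

(* X and Y may live on different probability spaces. Only measurable B are
   compared, since a measure carries no information on other sets. *)
Definition same_distribution (R : realType) (d d' : measure_display)
    (T : measurableType d) (T' : measurableType d') (P : probability T R)
    (Q : probability T' R) (X : {RV P >-> R}) (Y : {RV Q >-> R}) : Prop :=
  forall B : set R, measurable B -> distribution P X B = distribution Q Y B.

Definition mutually_independent (R : realType) (d : measure_display)
    (T : measurableType d) (P : probability T R) (I : finType)
    (X : I -> {RV P >-> R}) : Prop :=
  forall (J : {set I}) (B : I -> set R),
    (forall i, i \in J -> measurable (B i)) ->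
    P (\bigcap_(i in [set` J]) (X i @^-1` B i)) =
    (\prod_(i in J) P (X i @^-1` B i))%E.

(* The proposal z is accepted at absolute threshold t when strictly more than t
   agents vote for it; agent k votes for z iff 0 < z k. *)
Definition accepted (R : realType) (n : nat) (z : 'I_n -> R) (t : R) : bool :=
  t < #|[pred k | 0 < z k]|%:R.

(* The actual increment eta_i(alpha), as a function of the outcome. *)
Definition actual_increment (R : realType) (T : Type) (n : nat)
    (zeta : 'I_n -> T -> R) (alpha : R) (i : 'I_n) : T -> R :=
  fun w => zeta i w * (accepted (fun k => zeta k w) (alpha * n%:R))%:R.

Definition voting_threshold (R : realType) (n : nat) (alpha : R) : Prop :=
  - n%:R^-1 <= alpha <= 1.

Definition optimal_threshold (R : realType) (d : measure_display)
    (T : measurableType d) (P : probability T R) (n : nat)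
    (zeta : 'I_n -> T -> R) (alpha : R) : Prop :=
  voting_threshold n alpha /\
  forall beta : R, voting_threshold n beta -> forall i : 'I_n,
    ('E_P[actual_increment zeta beta i] <=
     'E_P[actual_increment zeta alpha i])%E.

(* Main.v *)
Require Import Defs.
From mathcomp Require Import all_boot all_order all_algebra.
From mathcomp Require Import all_classical all_reals all_analysis.
From mathcomp Require Import perm measurable_realfun ring.

Set Implicit Arguments.
Unset Strict Implicit.
Unset Printing Implicit Defensive.

Import Order.TTheory GRing.Theory Num.Theory.

Local Open Scope classical_set_scope.
Local Open Scope ring_scope.

(** Fix an agent [i] and split the outcomes according to the set [S] of agents
    whose increment is positive. Given that this set is [S], independence makes
    the mean increment of agent [i] equal to [E^+] when [i] is in [S] and to
    [- E^-] otherwise, whatever the other agents do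
    ([integral_vote_event]). Hence the expected increment is the sum, over the
    accepted sets [S], of the probability of [S] times one of these two numbers
    ([expectation_actual_increment]).

    The probability of [S] and its acceptance depend only on the number of
    elements of [S], so all agents have the same expected increment, and [n]
    times that expectation is the expected total increment of the society
    ([sum_perm_invariant]). A set with [x] elements contributes to this total a
    nonnegative multiple of [x E^+ - (n - x) E^-]. The best rule is therefore to
    accept when this quantity is positive and to reject when it is negative. It
    is positive exactly when [x > n E^- / (E^+ + E^-)], that is, when the
    proposal is accepted at the threshold [(1 + E^+ / E^-)^-1]. The comparison
    with any other threshold then holds separately for each [S]
    ([sum_votes_le]). *)

(** * Integrals under independence and equality of distributions *)

(** The restricted measure does not charge the complement of [D], and agrees
    with [mu] on the subsets of [D]. *)
Lemma ge0_integral_mrestr d (T : measurableType d) (R : realType)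
    (mu : measure T R) (D : set T) (mD : measurable D) (f : T -> \bar R) :
  measurable_fun [set: T] f -> (forall x, (0 <= f x)%E) ->
  (\int[mrestr mu mD]_x f x = \int[mu]_(x in D) f x)%E.
Proof.
move=> mf f0.
have -> : (\int[mu]_(x in D) f x = \int[mrestr mu mD]_(x in D) f x)%E.
  by apply: eq_measure_integral => A mA AD; rewrite /= /mrestr setIidl.
rewrite (@ge0_negligible_integral _ _ _ _ setT (~` D))//=.
- by rewrite setTD setCK.
- exact: measurableC.
- by rewrite /mrestr /= setICl measure0.
Qed.

(** The factorization hypothesis says that the image by [X] of [P] restricted to
    [B] is [P B] times the distribution of [X], so that the integrals of [f]
    against these two measures coincide. *)
Lemma ge0_integral_indep d (T : measurableType d) (R : realType)
    (P : probability T R) (X : {RV P >-> R}) (B : set T) (mB : measurable B)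
    (f : R -> \bar R) :
  (forall C, measurable C -> P (X @^-1` C `&` B) = (P (X @^-1` C) * P B)%E) ->
  measurable_fun [set: R] f -> (forall x, (0 <= f x)%E) ->
  (\int[P]_(w in B) f (X w) = \int[P]_w f (X w) * P B)%E.
Proof.
move=> XB mf f0.
have mfX : measurable_fun [set: T] (f \o X) by exact: measurableT_comp.
rewrite -(ge0_integral_mrestr P mB mfX (fun w => f0 (X w))).
have PB0 : 0 <= fine (P B) by rewrite fine_ge0.
have PBE : ((NngNum PB0)%:num%:E = P B)%E by rewrite /= fineK// fin_num_measure.
transitivity (\int[pushforward (mrestr P mB) X]_x f x)%E.
  by rewrite ge0_integral_pushforward.
transitivity (\int[mscale (NngNum PB0) (distribution P X)]_x f x)%E.
  apply: eq_measure_integral => C mC _.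
  by rewrite /= /mscale /= PBE muleC /pushforward /mrestr XB.
by rewrite ge0_integral_mscale// ge0_integral_distribution// PBE muleC.
Qed.

Lemma ge0_integral_same_distribution (R : realType) d d'
    (T : measurableType d) (T' : measurableType d') (P : probability T R)
    (Q : probability T' R) (X : {RV P >-> R}) (Y : {RV Q >-> R})
    (f : R -> \bar R) :
  same_distribution X Y ->
  measurable_fun [set: R] f -> (forall x, (0 <= f x)%E) ->
  (\int[P]_w f (X w) = \int[Q]_w f (Y w))%E.
Proof.
move=> XY mf f0; rewrite -[LHS](ge0_integral_distribution X mf f0).
rewrite -[RHS](ge0_integral_distribution Y mf f0).
by apply: eq_measure_integral => A mA _; exact: XY.
Qed.

Lemma integrable_same_distribution (R : realType) d d'
    (T : measurableType d) (T' : measurableType d') (P : probability T R)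
    (Q : probability T' R) (X : {RV P >-> R}) (Y : {RV Q >-> R}) :
  same_distribution X Y -> Q.-integrable [set: T'] (EFin \o Y) ->
  P.-integrable [set: T] (EFin \o X).
Proof.
move=> XY /integrableP[mY Yoo]; apply/integrableP; split.
  exact/measurable_EFinP.
have mabs : measurable_fun [set: R] (fun x : R => `|x%:E|%E).
  by apply: measurableT_comp => //; exact: measurable_EFin.
by rewrite (ge0_integral_same_distribution XY mabs).
Qed.

(** * The positive and nonpositive parts of a random variable *)

Definition side (R : realType) (b : bool) : set R := [set x | (0 < x) = b].

(** Absolute values make both parts nonnegative, so that the results on integrals
    of nonnegative functions apply to them; [side_absE] restores the sign. *)
Definition side_abs (R : realType) (b : bool) (x : R) : R :=
  if (0 < x) == b then `|x| else 0.

Lemma measurable_side (R : realType) b : measurable (@side R b).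
Proof.
have m0 : measurable [set x : R | 0 < x].
  have -> : [set x : R | 0 < x] = `]0, +oo[%classic.
    by apply/seteqP; split => x /=; rewrite in_itv/= andbT.
  exact: measurable_itv.
case: b; first exact: m0.
have -> : @side R false = ~` [set x | 0 < x].
  by apply/seteqP; split => x /=; rewrite /side /=; [move/negbT/negP|move/negP/negbTE].
exact: measurableC.
Qed.

Lemma measurable_preimage_side (R : realType) d (T : measurableType d)
    (P : probability T R) (X : {RV P >-> R}) b : measurable (X @^-1` side b).
Proof.
rewrite -[_ @^-1` _]setTI; apply: measurable_funP => //; exact: measurable_side.
Qed.

Lemma side_abs_ge0 (R : realType) b (x : R) : 0 <= side_abs b x.
Proof. by rewrite /side_abs; case: ifP. Qed.

Lemma side_absE (R : realType) b (x : R) :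
  side_abs b x = (-1) ^+ (~~ b) * (x * \1_(side b) x).
Proof.
rewrite /side_abs indicE; case: eqP => xb; last first.
  by rewrite memNset// !mulr0.
rewrite mem_set// mulr1; case: b xb => /=; rewrite ?expr0 ?expr1.
  by move=> x0; rewrite mul1r gtr0_norm.
by move/negbT; rewrite -leNgt => x0; rewrite mulN1r ler0_norm.
Qed.

Lemma measurable_side_abs (R : realType) b :
  measurable_fun [set: R] (fun x : R => (side_abs b x)%:E).
Proof.
apply/measurable_EFinP; rewrite (funext (side_absE b)).
apply: measurable_funM => //; apply: measurable_funM => //.
apply: measurable_indic; exact: measurable_side.
Qed.

(** The mean absolute value of [X] given the sign of [X]: [E^+] for [b = true]
    and [E^-] for [b = false], see [E_plusE] and [E_minusE]. *)
Definition side_mean (R : realType) d (T : measurableType d)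
    (P : probability T R) (X : T -> R) (b : bool) : R :=
  fine (\int[P]_w (side_abs b (X w))%:E) / fine (P (X @^-1` side b)).

Lemma side_mean_ge0 (R : realType) d (T : measurableType d)
    (P : probability T R) (X : T -> R) b : 0 <= side_mean P X b.
Proof.
rewrite divr_ge0// fine_ge0// integral_ge0// => w _.
by rewrite lee_fin side_abs_ge0.
Qed.

Lemma E_plusE (R : realType) d (T : measurableType d)
    (P : probability T R) (X : T -> R) : E_plus P X = side_mean P X true.
Proof.
rewrite /E_plus /cond_expectation /side_mean unlock.
congr (fine _ / _); apply: eq_integral => w _.
by rewrite side_absE mul1r !indicE.
Qed.

Lemma preimage_side_false (R : realType) (T : Type) (X : T -> R) :
  [set w | X w <= 0] = X @^-1` side false.
Proof.
apply/seteqP; split => w /=; rewrite /side /= leNgt; first by move/negbTE.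
by move=> ->.
Qed.

Lemma E_minusE (R : realType) d (T : measurableType d)
    (P : probability T R) (X : T -> R) : E_minus P X = side_mean P X false.
Proof.
rewrite -[RHS]ger0_norm ?side_mean_ge0//.
rewrite /E_minus /cond_expectation /side_mean unlock.
rewrite preimage_side_false.
rewrite !normrM; congr (_ * _).
rewrite -[RHS]normrN -fineN -integral_ge0N; last first.
  by move=> w _; rewrite lee_fin side_abs_ge0.
congr (`| fine _ |); apply: eq_integral => w _.
by rewrite side_absE expr1 mulN1r EFinN oppeK !indicE.
Qed.

(** * Comparison of acceptance thresholds *)

(** By invariance the sum on the left does not depend on [i], so [#|I|] times it
    is its sum over all [i]; a set [S] then collects [a] from its elements and
    [b] from the others. *)
Lemma sum_perm_invariant (R : realFieldType) (I : finType)
    (g : {set I} -> R) (i : I) (a b : R) :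
  (forall (s : {perm I}) (S : {set I}), g (s @: S)%SET = g S) ->
  #|I|%:R * (\sum_(S : {set I}) g S * (if i \in S then a else b)) =
  \sum_(S : {set I}) g S * (#|S|%:R * a + (#|I|%:R - #|S|%:R) * b).
Proof.
move=> gperm; pose F j := \sum_(S : {set I}) g S * (if j \in S then a else b).
have FE j : F j = F i.
  rewrite /F (reindex_inj (imset_inj (@perm_inj _ (tperm i j)))) /=.
  apply: eq_bigr => S _; rewrite gperm; congr (_ * _).
  by rewrite -{1}(tpermL i j) mem_imset//; exact: perm_inj.
transitivity (\sum_j F j).
  by rewrite [RHS](eq_bigr (fun=> F i))// sumr_const mulr_natl.
rewrite exchange_big /=; apply: eq_bigr => S _; rewrite -mulr_sumr.
congr (_ * _); rewrite (bigID (mem S)) /=.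
rewrite (eq_bigr (fun=> a)) => [|j ->//].
rewrite [X in _ + X](eq_bigr (fun=> b)) => [|j /negbTE ->//].
rewrite !sumr_const !mulr_natl; congr (_ + _).
by rewrite -[LHS]mulr_natl -(cardC S) natrD addrAC subrr add0r.
Qed.

(** The probability that [S] is exactly the set of agents in favour, when votes are
    independent and [p true], [p false] are the probabilities of a vote for and
    against. *)
Definition vote_weight (R : realFieldType) (I : finType) (p : bool -> R)
  (S : {set I}) : R := \prod_k p (k \in S).

Lemma vote_weight_perm (R : realFieldType) (I : finType) (p : bool -> R)
    (s : {perm I}) (S : {set I}) :
  vote_weight p (s @: S)%SET = vote_weight p S.
Proof.
rewrite /vote_weight (reindex_inj (@perm_inj _ s)) /=.
by apply: eq_bigr => k _; rewrite mem_imset//; exact: perm_inj.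
Qed.

(** After averaging over the agents, [S] contributes a nonnegative weight times
    [#|S| u - (n - #|S|) v], and the threshold [(1 + u / v)^-1] keeps exactly the
    sets for which this is positive. *)
Lemma sum_votes_le (R : realFieldType) (n : nat) (p : bool -> R) (u v : R)
    (beta : R) (i : 'I_n) :
  (forall b, 0 <= p b) -> 0 <= u -> 0 < v ->
  \sum_(S : {set 'I_n}) ((beta * n%:R < #|S|%:R)%R%:R * vote_weight p S) *
      (if i \in S then u else - v) <=
  \sum_(S : {set 'I_n}) (((1 + u / v)^-1 * n%:R < #|S|%:R)%R%:R *
      vote_weight p S) * (if i \in S then u else - v).
Proof.
move=> p0 u0 v0.
have n0 : 0 < #|'I_n|%:R :> R by rewrite ltr0n; apply/card_gt0P; exists i.
rewrite -(ler_pM2l n0) !sum_perm_invariant => [|s S|s S]; last 2 first.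
- by rewrite vote_weight_perm card_imset//; exact: perm_inj.
- by rewrite vote_weight_perm card_imset//; exact: perm_inj.
apply: ler_sum => S _; rewrite card_ord.
have w0 : 0 <= vote_weight p S by apply: prodr_ge0.
have -> : ((1 + u / v)^-1 * n%:R < #|S|%:R) =
          (0 < #|S|%:R * u + (n%:R - #|S|%:R) * - v).
  have -> : (1 + u / v)^-1 = v / (v + u).
    by field; rewrite ?gt_eqF//; apply: ltr_wpDr.
  rewrite mulrAC ltr_pdivrMr ?(ltr_wpDr u0)// -subr_gt0.
  by congr (_ < _); ring.
(* [c] is counted on the right exactly when it is positive. *)
rewrite -!mulrA; set c := _ + _.
have [c0|c0] := ltP 0 c; case: (_ < _); rewrite /= ?mul1r ?mul0r//.
  by rewrite mulr_ge0// ltW.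
by rewrite mulr_ge0_le0.
Qed.

(** * Conditioning on the set of supporters *)

Definition vote_event (R : realType) (T : Type) (I : finType)
    (X : I -> T -> R) (S : {set I}) : set T :=
  [set w | forall k, (0 < X k w) = (k \in S)].

(** Agent [i] is set apart so that, for mutually independent increments, the second
    factor is an event independent of [X i]. *)
Lemma vote_event_bigcap (R : realType) (T : Type) (I : finType)
    (X : I -> T -> R) (S : {set I}) (i : I) :
  vote_event X S = X i @^-1` side (i \in S) `&`
    \bigcap_(k in [set k | k != i]) (X k @^-1` side (k \in S)).
Proof.
apply/seteqP; split => w /=.
  by move=> wS; split => [|k _]; exact: wS.
by move=> [wi wS] k; have [->//|ki] := eqVneq k i; exact: wS.
Qed.

Lemma measurable_vote_event (R : realType) d (T : measurableType d)
    (P : probability T R) (I : finType) (X : I -> {RV P >-> R}) (S : {set I}) :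
  measurable (vote_event (fun i => X i : T -> R) S).
Proof.
have -> : vote_event (fun i => X i : T -> R) S =
    \bigcap_(k in [set: I]) (X k @^-1` side (k \in S)).
  by apply/seteqP; split => w wS k; [move=> _; exact: wS|exact: (wS k)].
apply: fin_bigcap_measurable => [|k _]; first exact: finite_finset.
exact: measurable_preimage_side.
Qed.

(** Mutual independence of the whole family, used with the set [C] for agent [i]
    and the sets [B k] for the others. *)
Lemma mutually_independent_others (R : realType) d (T : measurableType d)
    (P : probability T R) (I : finType) (X : I -> {RV P >-> R}) (i : I)
    (B : I -> set R) (C : set R) :
  mutually_independent X -> (forall k, measurable (B k)) -> measurable C ->
  P (X i @^-1` C `&` \bigcap_(k in [set k | k != i]) (X k @^-1` B k)) =
  (P (X i @^-1` C) * \prod_(k | k != i) P (X k @^-1` B k))%E.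
Proof.
move=> indX mB mC; pose B' k := if k == i then C else B k.
have B'i : B' i = C by rewrite /B' eqxx.
have := indX [set: I]%SET B'; rewrite (bigD1 i) ?inE//= B'i => indB.
transitivity (P (\bigcap_(k in [set` [set: I]%SET]) (X k @^-1` B' k))).
  congr (P _); apply/seteqP; split => w /=.
    by move=> [wC wB] k _; rewrite /B'; case: eqVneq => [->//|ki]; exact: wB.
  move=> wB; split; first by have := wB i; rewrite /= B'i; apply; rewrite inE.
  move=> k /= ki; have := wB k; rewrite /= /B' (negbTE ki); apply; rewrite inE//.
rewrite indB => [|k _]; last by rewrite /B'; case: ifP.
congr (_ * _)%E; apply: eq_big => k; first by rewrite inE.
by rewrite /B' inE /= => /negbTE ->.
Qed.

(** On this event the increment of [i] has constant sign, so its integral is, up to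
    this sign, that of its absolute value. By independence it is the product of
    the integral over the side of [i] and the probability that the other agents
    vote as [S] prescribes; the former is the conditional mean times the
    probability of that side, which completes the weight of [S]. *)
Lemma integral_vote_event (R : realType) d0 (T0 : measurableType d0)
    (P0 : probability T0 R) (zeta : {RV P0 >-> R})
    d (T : measurableType d) (P : probability T R) (I : finType)
    (zetas : I -> {RV P >-> R}) (S : {set I}) (i : I) :
  P0.-integrable [set: T0] (EFin \o zeta) ->
  (forall b, (0 < P0 (zeta @^-1` side b))%E) ->
  mutually_independent zetas ->
  (forall k, same_distribution (zetas k) zeta) ->
  (\int[P]_(w in vote_event (fun k => zetas k : T -> R) S) (zetas i w)%:E =
   (vote_weight (fun b => fine (P0 (zeta @^-1` side b))) S *
   (if i \in S then side_mean P0 zeta true else - side_mean P0 zeta false))%:E)%E.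
Proof.
move=> zeta_int zeta_gt0 indep copies.
set V := vote_event _ S; set b := i \in S.
set B := \bigcap_(k in [set k | k != i]) (zetas k @^-1` side (k \in S)).
pose p c := fine (P0 (zeta @^-1` side c)).
have mside c := measurable_preimage_side zeta c.
have pE c : P0 (zeta @^-1` side c) = (p c)%:E by rewrite fineK// fin_num_measure.
have p_gt0 c : 0 < p c by rewrite -lte_fin -pE.
have VE : V = zetas i @^-1` side b `&` B by exact: vote_event_bigcap.
have mB : measurable B.
  apply: fin_bigcap_measurable => [|k _]; first exact: finite_finset.
  exact: measurable_preimage_side.
have indB C : measurable C ->
    P (zetas i @^-1` C `&` B) = (P (zetas i @^-1` C) *
      (\prod_(k | k != i) p (k \in S))%:E)%E.
  move=> mC; rewrite (mutually_independent_others i (B := fun k => side (k \in S)))//.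
    congr (_ * _)%E; rewrite -prodEFin; apply: eq_bigr => k _.
    by rewrite -pE; apply: copies; exact: measurable_side.
  by move=> k; exact: measurable_side.
(* Taking for [C] the whole line gives the probability of [B] itself. *)
have PB : P B = (\prod_(k | k != i) p (k \in S))%:E.
  rewrite -[B]setTI -(preimage_setT (zetas i)) indB//.
  by rewrite preimage_setT probability_setT mul1e.
pose m := (\int[P0]_w (side_abs b (zeta w))%:E)%E.
have mE : m = (side_mean P0 zeta b * p b)%:E.
  rewrite /side_mean -/m mulfVK ?(gt_eqF (p_gt0 b))// fineK//.
  apply: integrable_fin_num => //; apply: le_integrable zeta_int => //.
    exact: (measurableT_comp (@measurable_side_abs R b)).
  move=> w _ /=; rewrite lee_fin /side_abs.
  by case: ifP; rewrite ?normr_id// normr0.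
have main : (\int[P]_(w in V) (side_abs b (zetas i w))%:E =
    (side_mean P0 zeta b * p b * \prod_(k | k != i) p (k \in S))%:E)%E.
  transitivity (\int[P]_(w in B) (side_abs b (zetas i w))%:E)%E.
    rewrite [LHS]integral_mkcond [RHS]integral_mkcond.
    apply: eq_integral => w _; rewrite !patchE VE in_setI.
    rewrite /side_abs; case: eqP => wb; first by rewrite mem_set.
    by rewrite memNset//; case: ifP.
  rewrite (ge0_integral_indep mB _ (@measurable_side_abs R b)); last 2 first.
  - by move=> C mC; rewrite indB// PB.
  - by move=> x; rewrite lee_fin side_abs_ge0.
  rewrite (ge0_integral_same_distribution (copies i) (@measurable_side_abs R b)); last first.
    by move=> x; rewrite lee_fin side_abs_ge0.
  by rewrite PB -/m mE EFinM.
have weightE : vote_weight p S = p b * \prod_(k | k != i) p (k \in S).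
  by rewrite /vote_weight (bigD1 i).
have Vside w : V w -> (zetas i w)%:E = ((-1) ^+ (~~ b) * side_abs b (zetas i w))%:E.
  move=> Vw; rewrite side_absE mulrA -signr_addb addbb expr0 mul1r indicE mem_set ?mulr1//.
rewrite -/p weightE.
have -> : (\int[P]_(w in V) (zetas i w)%:E =
    \int[P]_(w in V) (if b then (side_abs b (zetas i w))%:E else - (side_abs b (zetas i w))%:E))%E.
  apply: eq_integral => w /[!inE] /Vside ->.
  by case: (b); rewrite ?expr0 ?expr1 ?mul1r ?mulN1r.
case: (b) main => main; first by rewrite [LHS]main; congr EFin; ring.
transitivity (- \int[P]_(w in V) (side_abs false (zetas i w))%:E)%E.
  by apply: integral_ge0N => w _; rewrite lee_fin side_abs_ge0.
by rewrite main -EFinN; congr EFin; ring.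
Qed.

Lemma actual_incrementE (R : realType) (T : Type) (n : nat)
    (zetas : 'I_n -> T -> R) (alpha : R) (i : 'I_n) (w : T) :
  actual_increment zetas alpha i w =
  \sum_(S : {set 'I_n}) (alpha * n%:R < #|S|%:R)%R%:R *
    (zetas i w * \1_(vote_event zetas S) w).
Proof.
(* The set of agents in favour in [w] is the only [S] whose event contains
   [w]. *)
pose S0 := [set k | 0 < zetas k w]%SET.
have S0w : vote_event zetas S0 w by move=> k; rewrite inE.
rewrite (bigD1 S0)//= big1 ?addr0 => [|S SS0].
  rewrite indicE mem_set// mulr1 /actual_increment mulrC.
  by rewrite /accepted cardsE.
rewrite indicE memNset ?mulr0// => Sw.
by move/eqP: SS0; apply; apply/setP => k; rewrite -Sw inE.
Qed.

(** Integrating [actual_incrementE] term by term needs the integrability of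
    each increment, which is inherited from that of [zeta]. *)
Lemma expectation_actual_increment (R : realType) d0 (T0 : measurableType d0)
    (P0 : probability T0 R) (zeta : {RV P0 >-> R})
    d (T : measurableType d) (P : probability T R) (n : nat)
    (zetas : 'I_n -> {RV P >-> R}) (alpha : R) (i : 'I_n) :
  P0.-integrable [set: T0] (EFin \o zeta) ->
  (forall b, (0 < P0 (zeta @^-1` side b))%E) ->
  mutually_independent zetas ->
  (forall k, same_distribution (zetas k) zeta) ->
  ('E_P[actual_increment (fun k => zetas k : T -> R) alpha i] =
   (\sum_(S : {set 'I_n}) ((alpha * n%:R < #|S|%:R)%R%:R *
     vote_weight (fun b => fine (P0 (zeta @^-1` side b))) S) *
   (if i \in S then side_mean P0 zeta true else - side_mean P0 zeta false))%:E)%E.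
Proof.
move=> zeta_int zeta_gt0 indep copies.
have zetai_int := integrable_same_distribution (copies i) zeta_int.
pose V S := vote_event (fun k => zetas k : T -> R) S.
have mV S : measurable (V S) by exact: measurable_vote_event.
have V_int S : P.-integrable [set: T] (fun w => (zetas i w * \1_(V S) w)%:E).
  apply: le_integrable zetai_int => //.
    apply/measurable_EFinP; apply: measurable_funM => //; exact: measurable_indic.
  move=> w _ /=; rewrite lee_fin normrM indicE.
  by case: (_ \in _); rewrite ?normr1 ?normr0 ?mulr1 ?mulr0.
rewrite unlock.
under eq_integral do rewrite actual_incrementE -sumEFin.
rewrite integral_sum//; last first.
  by move=> S; under eq_fun do rewrite EFinM; exact: integrableZl.
rewrite -sumEFin; apply: eq_bigr => S _.
under eq_integral do rewrite EFinM.
rewrite integralZl// -mulrA EFinM; congr (_ * _)%E.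
rewrite -(integral_vote_event S i zeta_int zeta_gt0 indep copies) [RHS]integral_mkcond.
apply: eq_integral => w _; rewrite patchE indicE.
by case: (_ \in _); rewrite ?mulr1 ?mulr0.
Qed.

(** * The optimal threshold *)

Theorem theorem2 (R : realType)
    (d0 : measure_display) (T0 : measurableType d0) (P0 : probability T0 R)
    (zeta : {RV P0 >-> R})
    (zeta_int : P0.-integrable [set: T0] (EFin \o zeta))
    (zeta_pos : (0 < P0 [set w | (0 < zeta w)%R])%E)
    (zeta_npos : (0 < P0 [set w | (zeta w <= 0)%R])%E)
    (E_minus_gt0 : 0 < E_minus P0 zeta)
    (n : nat) (n_ge1 : (1 <= n)%N)
    (d : measure_display) (T : measurableType d) (P : probability T R)
    (zetas : 'I_n -> {RV P >-> R})
    (zetas_indep : mutually_independent zetas)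
    (zetas_copies : forall i : 'I_n, same_distribution (zetas i) zeta) :
  optimal_threshold P (fun i => zetas i : T -> R)
    (1 + E_plus P0 zeta / E_minus P0 zeta)^-1.
Proof.
have u0 : 0 <= E_plus P0 zeta by rewrite E_plusE side_mean_ge0.
have uv0 : 0 <= E_plus P0 zeta / E_minus P0 zeta by rewrite divr_ge0// ltW.
have side_gt0 b : (0 < P0 (zeta @^-1` side b))%E.
  case: b; first exact: zeta_pos.
  by move: zeta_npos; rewrite preimage_side_false.
split.
  apply/andP; split.
    by apply: (@le_trans _ _ 0); rewrite ?oppr_le0 ?invr_ge0// addr_ge0.
  by rewrite invf_le1 ?lerDl// ltr_wpDr.
move=> beta _ i.
rewrite !(expectation_actual_increment _ _ zeta_int)// lee_fin.
rewrite -E_plusE -E_minusE; apply: sum_votes_le => // b.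
exact: fine_ge0.
Qed.
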